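(* For each unital ring $R$ let $\approx_R$ be an equivalence relation on $R$ such that the family $\{\approx_R \mid R \text{ a unital ring}\}$ induces a well defined functor $F \colon \mathbf{Ring^1} \to \mathbf{Graph}$ in the following way: (i) For each unital ring $R$ the vertices of $F(R)$ are the equivalence classes $[r]_{\approx_R}$ of elements of $R$ with respect to $\approx_R$, and there is an edge between $[a]_{\approx_R}$ and $[b]_{\approx_R}$ if and only if $ab=ba$. (ii) For each unital ring morphism $f \colon R \to S$, where $R$ and $S$ are unital rings, the graph morphism $F(f) \colon F(R) \to F(S)$ is given by $F(f)([r]_{\approx_R}) = [f(r)]_{\approx_S}$ for all $r \in R$. Then for any finite unital algebra $A$ and for any $a,b \in A$, the condition $a \approx_A b$ implies $a \sim_1 b$.
   Context: Rings are associative; the zero ring is regarded as a unital ring with $1=0$. $\mathbf{Ring^1}$ is the category of unital rings and unital ring homomorphisms. $\mathbf{Graph}$ is the category of undirected simple graphs that allow loops, with graph homomorphisms as morphisms. ''Well defined'' means that the edges in (i) do not depend on the choice of representatives of the classes (i.e. if $a\approx_R a'$ and $b\approx_R b'$ then $ab=ba$ iff $a'b'=b'a'$), and that the maps in (ii) do not depend on the choice of representatives. A finite unital algebra is a unital associative algebra over a field that has finitely many elements. For a unital ring $A$ and $a\in A$, $\langle a\rangle_1=\{q(a)\mid q\in\mathbb{Z}[x]\}$ denotes the subring generated by $1$ and $a$, and $a\sim_1 b$ means $\langle a\rangle_1=\langle b\rangle_1$. *)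

(* Defs.v *)
From Stdlib Require Import RelationClasses.
From mathcomp Require Import all_boot all_order all_algebra.

Set Implicit Arguments.
Unset Strict Implicit.
Unset Printing Implicit Defensive.

Import GRing.Theory.
Local Open Scope ring_scope.

(* Ring^1 is modelled by pzRingType (unital rings, the zero ring included) with
   {rmorphism R -> S} (which preserves 1) as its morphisms. *)

(* Loops are allowed, so adjacency is only required to be symmetric. *)
Record graph := Graph {
  vertex :> Type;
  adj : vertex -> vertex -> Prop;
  adj_sym : forall x y, adj x y -> adj y x
}.

Record graph_hom (G H : graph) := GraphHom {
  graph_hom_fun :> vertex G -> vertex H;
  graph_hom_adj :
    forall x y, adj x y -> adj (graph_hom_fun x) (graph_hom_fun y)
}.

(* The object map is a parameter, so that the vertices of F0 R may be prescribed
   definitionally instead of up to a transport along an equality of types. *)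
Record functor_on (F0 : pzRingType -> graph) := FunctorOn {
  fmap :> forall R S : pzRingType, {rmorphism R -> S} -> graph_hom (F0 R) (F0 S);
  fmap_id : forall (R : pzRingType) (x : F0 R),
    @fmap R R (idfun : {rmorphism R -> R}) x = x;
  fmap_comp : forall (R S T : pzRingType)
      (f : {rmorphism R -> S}) (g : {rmorphism S -> T}) (x : F0 R),
    @fmap R T (g \o f : {rmorphism R -> T}) x = fmap g (fmap f x)
}.

Definition eq_class (T : Type) (e : T -> T -> Prop) : Type :=
  {X : T -> Prop | exists r : T, X = e r}.

Definition class_of (T : Type) (e : T -> T -> Prop) (r : T) : eq_class e :=
  exist _ (e r) (ex_intro (fun s : T => e r = e s) r erefl).

(* Well-definedness is the existence of an adjacency relation and of morphisms
   on classes that satisfy the formulas of (i) and (ii) for all representatives. *)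
Definition induces_functor
    (approx : forall R : pzRingType, R -> R -> Prop) : Prop :=
  exists (edge : forall R : pzRingType,
            eq_class (@approx R) -> eq_class (@approx R) -> Prop)
         (edge_sym : forall (R : pzRingType) (X Y : eq_class (@approx R)),
            edge R X Y -> edge R Y X)
         (F : functor_on (fun R : pzRingType => Graph (@edge_sym R))),
    (forall (R : pzRingType) (a b : R),
       edge R (class_of (@approx R) a) (class_of (@approx R) b)
       <-> a * b = b * a)
    /\ (forall (R S : pzRingType) (f : {rmorphism R -> S}) (r : R),
       F R S f (class_of (@approx R) r) = class_of (@approx S) (f r)).

(* The axioms of algType, restated because the library's algType excludes the
   zero algebra. *)
Record is_algebra (K : fieldType) (A : pzRingType) (scale : K -> A -> A) : Prop := {
  alg_scalerA : forall (k l : K) (x : A), scale k (scale l x) = scale (k * l) x;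
  alg_scale1r : forall x : A, scale 1 x = x;
  alg_scalerDr : forall (k : K) (x y : A), scale k (x + y) = scale k x + scale k y;
  alg_scalerDl : forall (k l : K) (x : A), scale (k + l) x = scale k x + scale l x;
  alg_scalerAl : forall (k : K) (x y : A), scale k (x * y) = scale k x * y;
  alg_scalerAr : forall (k : K) (x y : A), scale k (x * y) = x * scale k y
}.

Definition finitely_many (T : eqType) : Prop :=
  exists s : seq T, forall x : T, x \in s.

(* q(a); polynomial evaluation in the library requires a nonzero ring. *)
Definition int_eval (A : pzRingType) (q : {poly int}) (a : A) : A :=
  \sum_(i < size q) a ^+ i *~ q`_i.

Definition gen1 (A : pzRingType) (a : A) : A -> Prop :=
  fun x => exists q : {poly int}, x = int_eval q a.

Definition sim1 (A : pzRingType) (a b : A) : Prop :=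
  forall x : A, gen1 a x <-> gen1 b x.

(* Main.v *)
(* If a ≈ b in A, then f a and f b have the same centralizer in S for every
   morphism f : A -> S.  Take for S the ring of additive endomorphisms of A and
   for f the left regular representation.  It is enough to find an additive map
   phi : A -> A with values in <a>_1 that satisfies phi (a y) = a (phi y) and
   phi 1 = 1: then phi commutes with f a, hence with f b, so
   b = b (phi 1) = phi b lies in <a>_1.

   The ring <a>_1 is F_p[x]/(m) for the minimal polynomial m of a over the prime
   field, which is a Frobenius algebra: if L is a linear form on A that vanishes
   on a^0, ..., a^(d-2) and equals 1 at a^(d-1), with d = deg m, then
   phi y = sum_k m_k sum_(i+j+1=k) L(a^i y) a^j has these properties. *)
Require Import Defs.
From HB Require Import structures.
From Stdlib Require Import RelationClasses.
From mathcomp Require Import all_boot all_order all_algebra.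
From mathcomp Require Import boolp.

Set Implicit Arguments.
Unset Strict Implicit.
Unset Printing Implicit Defensive.

Import GRing.Theory.
Local Open Scope ring_scope.

(** * The ring of additive endomorphisms of an abelian group *)

Section AdditiveEndomorphisms.
Variable V : zmodType.

Record endo := Endo {
  endo_fun :> V -> V;
  endoB : forall x y, endo_fun (x - y) = endo_fun x - endo_fun y
}.

Lemma endo_ext (f g : endo) : f =1 g -> f = g.
Proof.
case: f g => [f fB] [g gB] /= /funext fg; rewrite fg in fB *.
by rewrite (Prop_irrelevance fB gB).
Qed.

HB.instance Definition _ := gen_eqMixin endo.
HB.instance Definition _ := gen_choiceMixin endo.

Lemma endo0 (f : endo) : f 0 = 0.
Proof. by rewrite -{1}(subrr 0) endoB subrr. Qed.

Lemma endoN (f : endo) x : f (- x) = - f x.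
Proof. by rewrite -sub0r endoB endo0 sub0r. Qed.

Lemma endoD (f : endo) x y : f (x + y) = f x + f y.
Proof. by rewrite -{1}(opprK y) endoB endoN opprK. Qed.

Lemma endoMn (f : endo) x n : f (x *+ n) = f x *+ n.
Proof. by elim: n => [|n IHn]; rewrite ?endo0 // !mulrS endoD IHn. Qed.

Lemma endo_sum (f : endo) (I : Type) (r : seq I) (F : I -> V) :
  f (\sum_(i <- r) F i) = \sum_(i <- r) f (F i).
Proof. exact: (big_morph f (endoD f) (endo0 f)). Qed.

Definition zero_endo : endo.
Proof. by exists (fun=> 0) => x y; rewrite subrr. Defined.

Definition opp_endo (f : endo) : endo.
Proof. by exists (fun x => - f x) => x y; rewrite endoB opprD. Defined.

Definition add_endo (f g : endo) : endo.
Proof. by exists (fun x => f x + g x) => x y; rewrite !endoB opprD addrACA. Defined.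

Definition one_endo : endo := @Endo id (fun x y => erefl).

Definition mul_endo (f g : endo) : endo.
Proof. by exists (fun x => f (g x)) => x y; rewrite !endoB. Defined.

Fact add_endoA : associative add_endo.
Proof. by move=> f g h; apply: endo_ext => x /=; rewrite addrA. Qed.

Fact add_endoC : commutative add_endo.
Proof. by move=> f g; apply: endo_ext => x /=; rewrite addrC. Qed.

Fact add_endo0 : left_id zero_endo add_endo.
Proof. by move=> f; apply: endo_ext => x /=; rewrite add0r. Qed.

Fact add_endoN : left_inverse zero_endo opp_endo add_endo.
Proof. by move=> f; apply: endo_ext => x /=; rewrite addNr. Qed.

HB.instance Definition _ :=
  GRing.isZmodule.Build endo add_endoA add_endoC add_endo0 add_endoN.

Fact mul_endoA : associative mul_endo.
Proof. by move=> f g h; apply: endo_ext. Qed.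

Fact mul_1endo : left_id one_endo mul_endo.
Proof. by move=> f; apply: endo_ext. Qed.

Fact mul_endo1 : right_id one_endo mul_endo.
Proof. by move=> f; apply: endo_ext. Qed.

Fact mul_endoDl : left_distributive mul_endo +%R.
Proof. by move=> f g h; apply: endo_ext. Qed.

Fact mul_endoDr : right_distributive mul_endo +%R.
Proof. by move=> f g h; apply: endo_ext => x /=; rewrite endoD. Qed.

HB.instance Definition _ := GRing.Zmodule_isPzRing.Build endo
  mul_endoA mul_1endo mul_endo1 mul_endoDl mul_endoDr.

Lemma add_endoE (f g : endo) x : (f + g) x = f x + g x.
Proof. by []. Qed.

Lemma mulrn_endoE (f : endo) n x : (f *+ n) x = f x *+ n.
Proof. by elim: n => [|n IHn] //; rewrite !mulrS add_endoE IHn. Qed.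

Lemma sum_endoE (I : Type) (r : seq I) (F : I -> endo) x :
  (\sum_(i <- r) F i) x = \sum_(i <- r) F i x.
Proof. by elim/big_rec2: _ => // i _ f _ <-. Qed.

End AdditiveEndomorphisms.

(** * The left regular representation as a unital ring morphism *)

Section LeftRegularRepresentation.
Variable A : pzRingType.

Definition lmul_endo (a : A) : endo A := @Endo A (fun x => a * x) (mulrBr a).

Fact lmul_endo_is_zmod_morphism : zmod_morphism lmul_endo.
Proof. by move=> a b; apply: endo_ext => x /=; rewrite mulrBl. Qed.

Fact lmul_endo_is_monoid_morphism : monoid_morphism lmul_endo.
Proof.
split=> [|a b]; first by apply: endo_ext => x /=; rewrite mul1r.
by apply: endo_ext => x /=; rewrite mulrA.
Qed.

HB.instance Definition _ :=
  GRing.isZmodMorphism.Build A (endo A) lmul_endo lmul_endo_is_zmod_morphism.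
HB.instance Definition _ :=
  GRing.isMonoidMorphism.Build A (endo A) lmul_endo lmul_endo_is_monoid_morphism.

End LeftRegularRepresentation.

(** By (ii), [f a] and [f b] have the same class in [S]; by (i), an edge from it to the class of [z]
    means commuting with [z], whichever representative is used. *)
Lemma approx_morph_commute (approx : forall R : pzRingType, R -> R -> Prop)
    (approx_equiv : forall R : pzRingType, Equivalence (approx R))
    (approx_functor : induces_functor approx)
    (R S : pzRingType) (f : {rmorphism R -> S}) (a b : R) (z : S) :
  approx R a b -> f a * z = z * f a -> f b * z = z * f b.
Proof.
move=> ab; case: approx_functor => edge [edge_sym] [F] [edgeP FP].
have eq_ab : class_of (@approx R) a = class_of (@approx R) b.
  apply: eq_exist; apply: funext => x; apply: propext.
  have [_ symR transR] := approx_equiv R.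
  by split=> [ax|bx]; [apply: transR (symR _ _ ab) ax | apply: transR ab bx].
by move=> /edgeP; rewrite -FP eq_ab FP => /edgeP.
Qed.

(** * Closure properties of the subring generated by one element *)

Section Gen1.
Variable A : pzRingType.
Implicit Types (a x y : A) (q : {poly int}).

(** Coefficients past the size default to 0; padding brings the sums of different polynomials to a
    common range. *)
Lemma int_evalE n q a : (size q <= n)%N ->
  int_eval q a = \sum_(i < n) a ^+ i *~ q`_i.
Proof.
move=> le_qn; rewrite /int_eval (big_ord_widen n (fun i => a ^+ i *~ q`_i)) //.
rewrite big_mkcond; apply: eq_bigr => i _.
by case: ltnP => // /(nth_default 0) ->.
Qed.

Lemma gen1B a x y : gen1 a x -> gen1 a y -> gen1 a (x - y).
Proof.
move=> [q ->] [r ->]; exists (q - r); pose n := maxn (size q) (size r).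
rewrite !(@int_evalE n) ?leq_maxl ?leq_maxr //; last first.
  by rewrite (leq_trans (size_polyD _ _)) // size_polyN.
by rewrite -sumrB; apply: eq_bigr => i _; rewrite coefB mulrzBr.
Qed.

Lemma gen1_0 a : gen1 a 0.
Proof. by exists 0; rewrite /int_eval size_poly0 big_ord0. Qed.

Lemma gen1_1 a : gen1 a 1.
Proof. by exists 1; rewrite /int_eval size_poly1 big_ord1 coef1. Qed.

Lemma gen1D a x y : gen1 a x -> gen1 a y -> gen1 a (x + y).
Proof.
move=> ax ay; rewrite -(opprK y) -(sub0r y).
by apply: gen1B => //; apply: gen1B => //; apply: gen1_0.
Qed.

Lemma gen1_sum a (I : Type) (r : seq I) (F : I -> A) :
  (forall i, gen1 a (F i)) -> gen1 a (\sum_(i <- r) F i).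
Proof. by move=> aF; elim/big_ind: _ => //; [apply: gen1_0 | apply: gen1D]. Qed.

Lemma gen1Mn a x n : gen1 a x -> gen1 a (x *+ n).
Proof.
move=> ax; elim: n => [|n IHn]; first exact: gen1_0.
by rewrite mulrS; apply: gen1D.
Qed.

Lemma gen1Mz a x (c : int) : gen1 a x -> gen1 a (x *~ c).
Proof.
move=> ax; case: c => n; first exact: gen1Mn.
by rewrite NegzE mulrNz -sub0r; apply: gen1B; [apply: gen1_0 | apply: gen1Mn].
Qed.

Lemma gen1Mgen a x : gen1 a x -> gen1 a (x * a).
Proof.
move=> [q ->]; exists (q * 'X).
rewrite (@int_evalE (size q).+1 (q * 'X)); last first.
  by rewrite (leq_trans (size_polyMleq _ _)) // size_polyX addn2.
rewrite big_ord_recl coefMX add0r /int_eval mulr_suml.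
by apply: eq_bigr => i _; rewrite coefMX /= exprSr mulrzAl.
Qed.

(** Expanding only [y] in powers of [a] reduces the product to repeated multiplication by [a], a
    mere shift of coefficients. *)
Lemma gen1M a x y : gen1 a x -> gen1 a y -> gen1 a (x * y).
Proof.
move=> ax [q ->]; rewrite /int_eval mulr_sumr; apply: gen1_sum => i.
rewrite mulrzAr; apply: gen1Mz; elim: (i : nat) => [|k IHk].
  by rewrite expr0 mulr1.
by rewrite exprSr mulrA; apply: gen1Mgen.
Qed.

Lemma gen1_gen a : gen1 a a.
Proof. by rewrite -[X in gen1 a X]mul1r; apply: gen1Mgen; apply: gen1_1. Qed.

Lemma gen1X a x n : gen1 a x -> gen1 a (x ^+ n).
Proof.
move=> ax; elim: n => [|n IHn]; first exact: gen1_1.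
by rewrite exprS; apply: gen1M.
Qed.

Lemma gen1_trans a b x : gen1 a b -> gen1 b x -> gen1 a x.
Proof.
move=> ab [q ->]; apply: gen1_sum => i.
by apply: gen1Mz; apply: gen1X.
Qed.

End Gen1.

(** * Linear algebra over F_p in an abelian group killed by [p] *)

Section ElementaryAbelian.
Variables (V : zmodType) (p : nat).
Hypotheses (p_pr : prime p) (pV : forall x : V, x *+ p = 0).
Implicit Types (H : pred V) (x y e : V) (t : seq V).

Lemma mulrn_modp x n : x *+ (n %% p) = x *+ n.
Proof. by rewrite {2}(divn_eq n p) mulrnDr mulnC mulrnA pV mul0rn add0r. Qed.

Lemma eq_mulrn_modp x m n : m = n %[mod p] -> x *+ m = x *+ n.
Proof. by move=> mn; rewrite -mulrn_modp mn mulrn_modp. Qed.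

(** Bezout: [u] inverts [n] modulo [p]. *)
Lemma mulrn_inv n : ~~ (p %| n)%N -> exists u, forall x, x *+ (n * u) = x.
Proof.
move=> p'n; have n_gt0 : (0 < n)%N by case: n p'n => //; rewrite dvdn0.
have [u v uv _] := egcdnP p n_gt0; exists u => x.
have /eqP g1 : coprime n p by rewrite coprime_sym prime_coprime.
by rewrite mulnC uv g1 mulrnDr mulnC mulrnA pV mul0rn add0r.
Qed.

Lemma mulrn_closed H x n : zmod_closed H -> x \in H -> x *+ n \in H.
Proof.
move=> /GRing.zmod_closedD [H0 HD] Hx.
by elim: n => [|n IHn]; rewrite ?mulr0n // mulrS HD.
Qed.

Lemma mulrn_mem H e n : zmod_closed H -> e \notin H -> e *+ n \in H -> (p %| n)%N.
Proof.
move=> Hz He; apply: contraLR => /mulrn_inv[u eu]; apply: contra He => He.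
by rewrite -(eu e) mulrnA mulrn_closed.
Qed.

(** The subgroup H + F_p y; bounding the multiplier by [p] keeps membership boolean. *)
Definition adjoin H y : pred V := fun x => [exists c : 'I_p, x - y *+ c \in H].

Lemma adjoinP H y x : reflect (exists n, x - y *+ n \in H) (x \in adjoin H y).
Proof.
apply: (iffP existsP) => [[c Hc]|[n Hn]]; first by exists c.
by exists (Ordinal (ltn_pmod n (prime_gt0 p_pr))); rewrite /= mulrn_modp.
Qed.

Lemma adjoin_closed H y : zmod_closed H -> zmod_closed (adjoin H y).
Proof.
move=> Hz; have [H0 HB] := Hz; split.
  by apply/adjoinP; exists 0%N; rewrite mulr0n subr0.
move=> x z /adjoinP[m Hm] /adjoinP[n Hn]; apply/adjoinP.
(* Multipliers are natural numbers, so [n * p.-1] stands for -n modulo [p]. *)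
exists (m + n * p.-1)%N.
have -> : y *+ (m + n * p.-1) = y *+ m - y *+ n.
  apply/eqP; rewrite mulrnDr -subr_eq0 opprB [y *+ n - _]addrC addrACA subrr add0r -mulrnDr.
  by rewrite addnC -mulnS prednK ?prime_gt0 // mulnC mulrnA pV mul0rn.
have -> : x - z - (y *+ m - y *+ n) = (x - y *+ m) - (z - y *+ n).
  by rewrite !opprB addrACA [RHS]addrACA [- z - _]addrC.
exact: HB.
Qed.

Lemma sub_adjoin H y x : x \in H -> x \in adjoin H y.
Proof. by move=> Hx; apply/adjoinP; exists 0%N; rewrite mulr0n subr0. Qed.

Lemma mem_adjoin H y : zmod_closed H -> y \in adjoin H y.
Proof. by move=> [H0 _]; apply/adjoinP; exists 1%N; rewrite mulr1n subrr. Qed.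

(** Greedy choice: each [y] of [t] is adjoined unless that would capture [e]. In the latter case
    [e - y *+ n] lies in [H] with [n] prime to [p], and inverting [n] puts [y] in H + F_p e
    already. *)
Lemma complement_line H e t : zmod_closed H -> e \notin H ->
  exists H', [/\ zmod_closed H', {subset H <= H'}, e \notin H'
               & {in t, forall y, y \in adjoin H' e}].
Proof.
elim: t H => [|y t IHt] H Hz He; first by exists H; split.
have [/adjoinP[n Hn]|Hye] := boolP (e \in adjoin H y); last first.
  have [H' [H'z sHH' H'e H't]] := IHt _ (adjoin_closed y Hz) Hye.
  exists H'; split=> // [x /sub_adjoin Hx|x]; first exact: sHH'.
  rewrite inE => /predU1P[->|/H't //].
  by apply/sub_adjoin/sHH'/mem_adjoin.
have /mulrn_inv[u nu] : ~~ (p %| n)%N.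
  apply: contra He => /dvdnP[k n_kp]; move: Hn.
  by rewrite n_kp mulnC mulrnA pV mul0rn subr0.
have [H' [H'z sHH' H'e H't]] := IHt _ Hz He.
exists H'; split=> // x; rewrite inE => /predU1P[->|/H't //].
apply/adjoinP; exists u; have /GRing.zmod_closedN H'N := H'z.
rewrite -opprB; apply: H'N; rewrite -{1}(nu y) mulrnA -mulrnBl.
by apply: mulrn_closed (sHH' _ Hn).
Qed.

(* Linear forms to F_p, written with representatives in nat. *)
Lemma linear_form_exists H e t : (forall x, x \in t) ->
  zmod_closed H -> e \notin H ->
  exists f : V -> nat,
    [/\ forall x y, f (x + y) = f x + f y %[mod p],
        {in H, forall x, f x = 0 %[mod p]} & f e = 1 %[mod p]].
Proof.
move=> tV Hz He; have [H' [H'z sHH' H'e H't]] := complement_line t Hz He.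
have [H'0 H'B] := H'z; have [_ H'D] := GRing.zmod_closedD H'z.
have ex_coef x : exists n, x - e *+ n \in H' by apply/adjoinP/H't.
have coef_uniq x m n : x - e *+ m \in H' -> x - e *+ n \in H' -> m = n %[mod p].
  wlog le_mn : m n / (m <= n)%N => [wl|] H'm H'n.
    by have [/wl|/ltnW/wl] := leqP m n; first exact; move=> h; apply/esym/h.
  apply/eqP; rewrite eq_sym eqn_mod_dvd //; apply: mulrn_mem H'z H'e _.
  have := H'B _ _ H'm H'n.
  by rewrite opprB addrC addrA subrK mulrnBr.
(* [f x] is the coordinate of [x] along [e] modulo [H']. It is unique modulo [p], so each property
   follows by exhibiting a second valid coordinate. *)
pose f x := xchoose (ex_coef x).
have fP x : x - e *+ f x \in H' := xchooseP (ex_coef x).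
exists f; split=> [x y|x Hx|].
- apply: coef_uniq (fP _) _.
  by rewrite mulrnDr opprD addrACA; apply: H'D.
- by apply: coef_uniq (fP _) _; rewrite subr0; apply: sHH'.
- by apply: coef_uniq (fP _) _; rewrite subrr.
Qed.

End ElementaryAbelian.

(** Pigeonhole on the first [(size t).+1] values; it serves for the powers of [a] and for the
    multiples of 1. *)
Lemma finite_repeat (T : eqType) (t : seq T) (f : nat -> T) :
  (forall x, x \in t) -> exists i, exists2 j, (i < j)%N & f i = f j.
Proof.
move=> tT; pose s := mkseq f (size t).+1.
have : ~~ uniq s.
  apply/negP => /uniq_leq_size /(_ (fun x _ => tT x)).
  by rewrite size_mkseq ltnn.
case/(uniqPn (f 0%N)) => i [j []] /[swap].
rewrite size_mkseq => ltj ltij; rewrite !nth_mkseq ?(ltn_trans ltij) // => fij.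
by exists i, j.
Qed.

(** * An additive retraction of [A] onto the subring generated by [a], commuting with multiplication
    by [a] *)

Section Retraction.
Variables (A : pzRingType) (a : A).

Section Convolution.
Variable L : endo A.
Hypothesis L_central : forall x y, L x * y = y * L x.

(* convolution k y = \sum_(i + j + 1 = k) L (a ^+ i * y) * a ^+ j *)
Fixpoint convolution k : endo A :=
  if k is j.+1 then lmul_endo a * convolution j + L * lmul_endo (a ^+ j) else 0.

(** The recursive definition splits off the term j = 0; this splits off i = 0 instead. Comparing the
    two gives [convolution_mulgen]. *)
Lemma convolutionSr k y :
  convolution k.+1 y = convolution k (a * y) + L y * a ^+ k.
Proof.
elim: k => [|k IHk]; first by rewrite /= mulr0 expr0 mul1r mulr1.
have -> : convolution k.+2 y = a * convolution k.+1 y + L (a ^+ k.+1 * y) by [].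
rewrite IHk mulrDr addrAC exprSr -mulrA; congr (_ + _).
by rewrite mulrA -L_central -mulrA -exprS -exprSr.
Qed.

Lemma convolution_mulgen k y :
  convolution k (a * y) = a * convolution k y + (L (a ^+ k * y) - L y * a ^+ k).
Proof. by rewrite addrA; apply/eqP; rewrite eq_sym subr_eq -convolutionSr. Qed.

Lemma convolution_eq0 k : (forall i, (i < k)%N -> L (a ^+ i) = 0) ->
  convolution k 1 = 0.
Proof.
elim: k => // k IHk La /=; rewrite mulr1 La // addr0.
by rewrite IHk ?mulr0 // => i /ltnW; apply: La.
Qed.

Lemma gen1_convolution k y : (forall x, gen1 a (L x)) -> gen1 a (convolution k y).
Proof.
move=> La; elim: k => [|k IHk] /=; first exact: gen1_0.
by apply: gen1D (La _); apply: gen1M => //; apply: gen1_gen.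
Qed.

Lemma convolution_retraction d (c : nat -> nat) :
    a ^+ d.+1 = \sum_(k < d.+1) a ^+ k *+ c k ->
    (forall i, (i < d)%N -> L (a ^+ i) = 0) -> L (a ^+ d) = 1 ->
    (forall x, gen1 a (L x)) ->
  exists phi : endo A,
    [/\ forall y, phi (a * y) = a * phi y, phi 1 = 1 & forall y, gen1 a (phi y)].
Proof.
move=> a_d L0 L1 La.
(* The minimal polynomial m has degree [d.+1] here, with lower coefficients [- c k]. The defects of
   commuting with [a] add up to L(m(a) y) - L(y) m(a) = 0, and at 1 only the term [L (a ^+ d)]
   survives. *)
pose phi := convolution d.+1 - \sum_(k < d.+1) convolution k *+ c k.
have phiE y : phi y =
    convolution d.+1 y - \sum_(k < d.+1) convolution k y *+ c k.
  rewrite add_endoE; congr (_ - _); rewrite sum_endoE.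
  by apply: eq_bigr => k _; rewrite mulrn_endoE.
exists phi; split=> [y||y]; rewrite !phiE.
- rewrite convolution_mulgen mulrBr mulr_sumr.
  under eq_bigr do rewrite convolution_mulgen mulrnDl mulrnBl.
  rewrite big_split sumrB.
  under [X in a * _ - X]eq_bigr do rewrite mulrnAr.
  have -> : \sum_(k < d.+1) L (a ^+ k * y) *+ c k = L (a ^+ d.+1 * y).
    rewrite a_d mulr_suml endo_sum; apply: eq_bigr => k _.
    by rewrite mulrnAl endoMn.
  have -> : \sum_(k < d.+1) L y * a ^+ k *+ c k = L y * a ^+ d.+1.
    by rewrite a_d mulr_sumr; apply: eq_bigr => k _; rewrite mulrnAr.
  by rewrite opprD addrACA subrr addr0.
- rewrite big1 ?subr0 => [|k _].
    by rewrite /= mulr1 L1 (convolution_eq0 L0) mulr0 add0r.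
  rewrite convolution_eq0 ?mul0rn // => i lt_ik; apply: L0.
  by apply: leq_trans lt_ik _; rewrite -ltnS.
- apply: gen1B; first exact: gen1_convolution.
  by apply: gen1_sum => k; apply/gen1Mn/gen1_convolution.
Qed.

End Convolution.

(** * The minimal polynomial of [a] over the prime field *)

Variables (p : nat) (t : seq A).
Hypotheses (p_pr : prime p) (pA : forall x : A, x *+ p = 0).
Hypothesis tA : forall x : A, x \in t.

(** The F_p-span of the powers of [a] with exponent below [n]. *)
Fixpoint power_span n : pred A :=
  if n is k.+1 then adjoin p (power_span k) (a ^+ k) else pred1 0.

Lemma power_span_closed n : zmod_closed (power_span n).
Proof.
elim: n => [|n IHn]; last exact: adjoin_closed.
by split=> [|x y]; rewrite !inE // => /eqP-> /eqP->; rewrite subrr.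
Qed.

Lemma power_spanP n x : x \in power_span n ->
  exists c : nat -> nat, x = \sum_(k < n) a ^+ k *+ c k.
Proof.
elim: n x => [|n IHn] x.
  by move=> /eqP->; exists (fun=> 0%N); rewrite big_ord0.
move=> /(adjoinP p_pr pA)[m /IHn[c xE]].
exists (fun k => if k == n then m else c k).
rewrite big_ord_recr /= eqxx -[LHS](subrK (a ^+ n *+ m)) xE; congr (_ + _).
by apply: eq_bigr => k _; rewrite ltn_eqF.
Qed.

Lemma mem_power_span i n : (i < n)%N -> a ^+ i \in power_span n.
Proof.
elim: n => // n IHn; rewrite ltnS leq_eqVlt => /predU1P[->|/IHn].
  by apply: mem_adjoin => //; apply: power_span_closed.
exact: sub_adjoin.
Qed.

Lemma power_dependent : exists n, a ^+ n \in power_span n.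
Proof.
have [i [j ltij /= aij]] := finite_repeat (GRing.exp a) tA.
by exists j; rewrite -aij; apply: mem_power_span.
Qed.

Lemma gen1_retraction : exists phi : endo A,
  [/\ forall y, phi (a * y) = a * phi y, phi 1 = 1 & forall y, gen1 a (phi y)].
Proof.
(* The least such exponent is the degree of the minimal polynomial; it is 0 only in the zero ring,
   where the identity serves as [phi]. *)
case: (ex_minnP power_dependent) => [[|d]].
  rewrite expr0 inE => /eqP A0 _; exists 1; split=> // y.
  by rewrite -[X in gen1 a X]mulr1 A0 mulr0; apply: gen1_0.
move=> /power_spanP[c a_d] min_d.
(* By minimality some form vanishes on the powers below [d] but not at [a ^+ d]. *)
have a'd : a ^+ d \notin power_span d.
  by apply/negP => /min_d; rewrite ltnn.
have [f [fD f0 f1]] :=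
  linear_form_exists p_pr pA tA (power_span_closed d) a'd.
(* [f] is additive only modulo [p]; taking multiples of 1 makes it additive, with values that are
   central and in the generated subring. *)
have LD x y : 1 *+ f (x + y) = 1 *+ f x + 1 *+ f y :> A.
  by rewrite -mulrnDr; apply: eq_mulrn_modp (fD x y).
have LB x y : 1 *+ f (x - y) = 1 *+ f x - 1 *+ f y :> A.
  by rewrite -[in RHS](subrK y x) (LD (x - y)) addrK.
apply: (@convolution_retraction (@Endo A (fun x => 1 *+ f x) LB) _ d c) => //=.
- by move=> x y; rewrite mulrnAl mulrnAr mul1r mulr1.
- move=> i /mem_power_span /f0.
  exact: eq_mulrn_modp.
- exact: eq_mulrn_modp f1.
- by move=> x; apply: gen1Mn; apply: gen1_1.
Qed.

End Retraction.

(** Multiples of 1 repeat, so some n > 0 kills 1 in [A]. If n were invertible in [K], scaling by its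
    inverse would give 1 = 0; hence [K] has prime characteristic. *)
Lemma finite_algebra_pchar (K : fieldType) (A : pzRingType) (scale : K -> A -> A) :
  is_algebra scale -> finitely_many A -> (1 : A) != 0 ->
  exists2 p, prime p & forall x : A, x *+ p = 0.
Proof.
move=> [scaleA scale1 scaleDr scaleDl _ _] [t tA] A1.
have scale0 x : scale 0 x = 0.
  by apply: (addrI (scale 0 x)); rewrite -scaleDl !addr0.
have scale_nat n x : scale n%:R x = x *+ n.
  by elim: n => [|n IHn]; rewrite ?scale0 // !mulrS scaleDl scale1 IHn.
have scaler0 k : scale k 0 = 0.
  by apply: (addrI (scale k 0)); rewrite -scaleDr !addr0.
have [n n_gt0 An] : exists2 n, (0 < n)%N & 1 *+ n = 0 :> A.
  have [i [j ltij /= aij]] := finite_repeat (fun n => 1 *+ n) tA.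
  exists (j - i)%N; first by rewrite subn_gt0.
  by rewrite mulrnBr ?aij ?subrr // ltnW.
have Kn : n%:R == 0 :> K.
  apply: contraNT A1 => Kn; rewrite -(scale1 1) -(mulVf Kn) -scaleA.
  by rewrite scale_nat An scaler0.
have [p pK] := natf0_pchar n_gt0 Kn.
exists p; first exact: pcharf_prime pK.
by move=> x; rewrite -scale_nat (pcharf0 pK) scale0.
Qed.

(** * From commuting with the retraction to equality of the generated subrings *)

Lemma approx_gen1 (approx : forall R : pzRingType, R -> R -> Prop)
    (approx_equiv : forall R : pzRingType, Equivalence (approx R))
    (approx_functor : induces_functor approx)
    (K : fieldType) (A : pzRingType) (scale : K -> A -> A)
    (A_algebra : is_algebra scale) (A_finite : finitely_many A) (a b : A) :
  approx A a b -> gen1 a b.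
Proof.
(* The zero algebra may lie over a field of characteristic 0, so it is treated apart. *)
move=> ab; have [A0|A1] := eqVneq (1 : A) 0.
  by rewrite -[X in gen1 a X]mulr1 A0 mulr0; apply: gen1_0.
have [p p_pr pA] := finite_algebra_pchar A_algebra A_finite A1.
have [t tA] := A_finite.
have [phi [phia phi1 phi_gen]] := gen1_retraction a p_pr pA tA.
have phi_comm : lmul_endo a * phi = phi * lmul_endo a.
  by apply: endo_ext => y; rewrite /= phia.
have := approx_morph_commute approx_equiv approx_functor ab phi_comm.
move=> /(congr1 (fun f : endo A => f 1)) /=.
by rewrite phi1 mulr1 => ->.
Qed.

Theorem theorem7
    (approx : forall R : pzRingType, R -> R -> Prop)
    (approx_equiv : forall R : pzRingType, Equivalence (approx R))
    (approx_functor : induces_functor approx)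
    (K : fieldType) (A : pzRingType) (scale : K -> A -> A)
    (A_algebra : is_algebra scale) (A_finite : finitely_many A)
    (a b : A) :
  approx A a b -> sim1 a b.
Proof.
move=> ab x; have [_ symA _] := approx_equiv A; have ba := symA _ _ ab.
have gen_ab := approx_gen1 approx_equiv approx_functor A_algebra A_finite ab.
have gen_ba := approx_gen1 approx_equiv approx_functor A_algebra A_finite ba.
by split; apply: gen1_trans.
Qed.
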